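(* For every $\gamma,q\in(0,1]$, every $\gamma'\in(0,1)$, every $\alpha\geq1$, and every $\alpha'\geq\gamma'$, \[ \tilde{\mathcal{F}}_{\gamma,\max\{\alpha,1/q\}}\supseteq\tilde{\mathcal{F}}_{\gamma}\cup\mathcal{F}_{\alpha}\cup\mathcal{F}_{q}\qquad\text{and}\qquad\tilde{\mathcal{F}}_{\gamma',\alpha'}\nsubseteq\tilde{\mathcal{F}}_{\gamma}\cup\mathcal{F}_{\alpha}\cup\mathcal{F}_{q}. \]
   Context: All functions are set functions $f\colon 2^{U}\to\mathbb{R}_{\geq0}$ on some finite ground set $U$; $f$ is monotone if $X\subseteq Y$ implies $f(X)\leq f(Y)$. Write $[n]=\{1,\dots,n\}$. The greedy algorithm produces $x_1,x_2,\dots$ with $x_i\in\arg\max_{x\in U\setminus\{x_1,\dots,x_{i-1}\}} f(\{x_1,\dots,x_{i-1}\}\cup\{x\})$, and $S^{G}_i=\{x_1,\dots,x_i\}$, $S^{G}_0=\emptyset$; ties are broken by some rule, and each function is considered together with a fixed such greedy run, to which all notions referring to greedy sets refer. $\bar{k}\in[|U|]$ is the smallest index such that $f(S^{G}_{\bar k}\cup\{x\})=f(S^{G}_{\bar k})$ for all $x\in U\setminus S^{G}_{\bar k}$. Weak submodularity ratio: $\gamma(f)=\min_{X\in\{S^{G}_0,\dots,S^{G}_{\bar k}\},\,Y\subseteq U\setminus X}\frac{\sum_{y\in Y}(f(X\cup\{y\})-f(X))}{f(X\cup Y)-f(X)}$ with $\frac00:=1$. $\tilde{\mathcal{F}}_{\gamma}$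 is the set of all monotone $f$ with $\gamma(f)\geq\gamma$. For $\alpha\geq1$, $f$ is $\alpha$-augmentable if for all $X\subseteq U$ and $Y\subseteq U$ with $Y\nsubseteq X$ there is $y\in Y\setminus X$ with $f(X\cup\{y\})-f(X)\geq\frac{f(X\cup Y)-\alpha f(X)}{|Y|}$. $\mathcal{F}_{\alpha}$ is the set of monotone $\alpha$-augmentable functions. For $\gamma\in(0,1]$, $\alpha\geq\gamma$, $f$ is weakly $\gamma$-$\alpha$-augmentable if for all $X\in\{S^{G}_0,\dots,S^{G}_{\bar k}\}$ and all $Y\subseteq U$ with $Y\nsubseteq X$ there is $y\in Y$ with $f(X\cup\{y\})-f(X)\geq\frac{\gamma f(X\cup Y)-\alpha f(X)}{|Y|}$. $\tilde{\mathcal{F}}_{\gamma,\alpha}$ is the set of monotone weakly $\gamma$-$\alpha$-augmentable functions. An independence system $(U,\mathcal{I})$ has $\emptyset\in\mathcal{I}\subseteq 2^U$ with $\mathcal{I}$ closed under subsets. For $w\colon U\to\mathbb{R}_{\geq0}$ its weighted rank function is $f(X)=\max\{\sum_{x\in Y}w(x)\mid Y\in\mathcal{I}\cap 2^{X}\}$. The bases $\mathcal{B}(X)$ of $X$ are the inclusion-wise maximal sets of $\mathcal{I}\cap2^X$; the rank quotient is $q(U,\mathcal{I})=\min_{X\subseteq U}\min_{B,B'\in\mathcal{B}(X)}|B|/|B'|$ with $\frac00:=1$. $\mathcal{F}_q$ is the set of weighted rank functions of independence systems with rank quotient at least $q$. *)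

(* Defs.v *)
From mathcomp Require Import all_boot all_order all_algebra.
From mathcomp Require Import reals.
Set Implicit Arguments.
Unset Strict Implicit.
Unset Printing Implicit Defensive.
Import Order.TTheory GRing.Theory Num.Theory.
Local Open Scope ring_scope.

Section SetFunctions.
Variables (R : realType) (U : finType).
Implicit Types (f : {set U} -> R) (run : #|U|.-tuple U) (X Y : {set U}).

(* Division with the convention 0 / 0 = 1. *)
Definition quot (a b : R) : R := if (a == 0) && (b == 0) then 1 else a / b.

Definition monotone f : Prop := forall X Y, X \subset Y -> f X <= f Y.

Definition greedy_set run (i : nat) : {set U} := [set x in take i run].

(* [tnth run i] is x_(i+1); the run is continued until U is exhausted. *)
Definition is_greedy_run f run : Prop :=
  forall i : 'I_#|U|,
    tnth run i \notin greedy_set run i /\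
    forall y, y \notin greedy_set run i ->
      f (greedy_set run i :|: [set y]) <= f (greedy_set run i :|: [set tnth run i]).

Definition saturated f X : bool :=
  [forall x in ~: X, f (X :|: [set x]) == f X].

(* The least k with 1 <= k <= |U| such that S_k is saturated: k = |U| always
   qualifies when U is nonempty. For U empty there is no such k and the value
   is 0. *)
Definition kbar f run : 'I_#|U|.+1 :=
  [arg min_(k < ord_max | (0 < k)%N && saturated f (greedy_set run k)) k]%N.

Definition marginal_ratio f X Y : R :=
  quot (\sum_(y in Y) (f (X :|: [set y]) - f X)) (f (X :|: Y) - f X).

(* The default value 1 of the iterated minimum is the ratio at Y = set0. *)
Definition weak_submodularity_ratio f run : R :=
  \big[Num.min/1]_(i < (kbar f run).+1)
    \big[Num.min/1]_(Y : {set U} | Y \subset ~: greedy_set run i)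
      marginal_ratio f (greedy_set run i) Y.

Definition augmentable (alpha : R) f : Prop :=
  forall X Y, ~~ (Y \subset X) ->
    exists2 y, y \in Y :\: X &
      f (X :|: [set y]) - f X >= (f (X :|: Y) - alpha * f X) / #|Y|%:R.

Definition weakly_augmentable (gamma alpha : R) f run : Prop :=
  forall i : nat, (i <= kbar f run)%N ->
  forall Y, ~~ (Y \subset greedy_set run i) ->
    exists2 y, y \in Y &
      f (greedy_set run i :|: [set y]) - f (greedy_set run i) >=
      (gamma * f (greedy_set run i :|: Y) - alpha * f (greedy_set run i))
        / #|Y|%:R.

Definition independence_system (I : {set {set U}}) : Prop :=
  set0 \in I /\ forall X Y, X \subset Y -> Y \in I -> X \in I.

(* The default value 0 of the iterated maximum is the weight of set0 \in I. *)
Definition weighted_rank (I : {set {set U}}) (w : U -> R) X : R :=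
  \big[Num.max/0]_(Y in I | Y \subset X) \sum_(x in Y) w x.

Definition bases (I : {set {set U}}) X : {set {set U}} :=
  [set B | maxset (fun B' : {set U} => (B' \in I) && (B' \subset X)) B].

(* The default value 1 of the iterated minimum is the quotient at X = set0. *)
Definition rank_quotient (I : {set {set U}}) : R :=
  \big[Num.min/1]_(X : {set U})
    \big[Num.min/1]_(B in bases I X)
      \big[Num.min/1]_(B' in bases I X) quot #|B|%:R #|B'|%:R.

Definition weighted_rank_function (q : R) f : Prop :=
  exists (I : {set {set U}}) (w : U -> R),
    [/\ independence_system I, forall x, 0 <= w x,
        rank_quotient I >= q & forall X, f X = weighted_rank I w X].

End SetFunctions.

Arguments rank_quotient R {U} I.

(* A nonnegative set function on some finite ground set, together with the
   fixed greedy run to which all notions involving greedy sets refer. *)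
Record greedy_fun (R : realType) := GreedyFun {
  ground : finType;
  fn :> {set ground} -> R;
  fn_ge0 : forall X, 0 <= fn X;
  run : #|ground|.-tuple ground;
  run_greedy : is_greedy_run fn run
}.
Arguments run {R} g.

(* The classes of functions are predicates: universe constraints prevent
   [greedy_fun R] from being the carrier of a classical_sets set. *)
Section Classes.
Variable R : realType.

Definition Fweaksub (gamma : R) (f : greedy_fun R) : Prop :=
  monotone f /\ weak_submodularity_ratio f (run f) >= gamma.

Definition Faug (alpha : R) (f : greedy_fun R) : Prop :=
  monotone f /\ augmentable alpha f.

Definition Fweakaug (gamma alpha : R) (f : greedy_fun R) : Prop :=
  monotone f /\ weakly_augmentable gamma alpha f (run f).

Definition Frank (q : R) (f : greedy_fun R) : Prop :=
  weighted_rank_function q f.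

End Classes.

(* Main.v *)
(** A greedy run on a weighted rank function picks elements of nonincreasing
    weight and keeps the greedy set S independent, until no element brings a
    gain; moreover S blocks each y that brings no gain already with its elements
    of weight at least w(y).  Hence, if d is the largest gain of an element of Y
    and the weights outside S are lowered by d, every upper level set of S is a
    basis of the corresponding level set of S ∪ Y, and summing the rank quotient
    over the levels gives f(S ∪ Y) - d |Y| <= f(S) / q.  For sets S that are not
    greedy this bound can fail, so the greedy structure is essential.

    For the strictness, take f(X) = 1 + c (|X| - 1) if X contains a fixed hub and
    f(X) = 0 otherwise, with c = 1 / gamma'.  From the empty set only the hub
    yields a gain, namely 1, while f(U) > |U| grows without bound. *)

Require Import Defs.
From mathcomp Require Import all_boot all_order all_algebra.
From mathcomp Require Import reals boolp lra.
Set Implicit Arguments.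
Unset Strict Implicit.
Unset Printing Implicit Defensive.
Import Order.TTheory GRing.Theory Num.Theory.
Local Open Scope ring_scope.

(** * Comparing sums through level sets *)

Section Sums.
Variables (R : realType) (T : finType).
Implicit Types (v : T -> R) (A B : {set T}).

Lemma ler_sum_subset v A B :
  (forall x, 0 <= v x) -> A \subset B -> \sum_(x in A) v x <= \sum_(x in B) v x.
Proof.
move=> v0 sAB; rewrite (big_setID A (A := B)) /= (setIidPr sAB) lerDl.
exact: sumr_ge0.
Qed.

(* Layer-cake comparison; the induction peels off the lowest positive layer. *)
Lemma ler_sum_level_sets v (c : R) A B :
  (forall x, 0 <= v x) ->
  (forall t, 0 < t -> #|[set x in A | t <= v x]|%:R
                       <= c * #|[set x in B | t <= v x]|%:R) ->
  \sum_(x in A) v x <= c * \sum_(x in B) v x.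
Proof.
have [m] := ubnP #|[set x | 0 < v x]|.
elim: m v => // m IH v lt_m v0 lev.
have [/eqP s0|/set0Pn[x0]] := boolP ([set x | 0 < v x] == set0).
  have vE x : v x = 0.
    apply/eqP; rewrite eq_le v0 andbT leNgt; apply/negP => vx.
    by move/setP/(_ x): s0; rewrite !inE vx.
  by rewrite !big1 ?mulr0 // => x _; rewrite vE.
rewrite inE => x0P.
(* [t] is the least positive weight: all weights below it vanish, so lowering by [t] splits off
   exactly the level set at [t], and [x1] leaves the support. *)
have [x1 t0 tmin] := @Order.TotalTheory.arg_minP _ _ _ x0 (fun x => 0 < v x) v x0P.
set t := v x1 in t0 tmin.
pose v' x := Num.max 0 (v x - t).
have split_sum C : \sum_(x in C) v x =
    \sum_(x in C) v' x + t * #|[set x in C | t <= v x]|%:R.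
  rewrite -sum1_card natr_sum mulr_sumr.
  under [X in _ = _ + X]eq_bigl do rewrite inE.
  rewrite big_mkcondr -big_split /=; apply: eq_bigr => x _; rewrite /v'.
  case: (lerP t (v x)) => tv; first by rewrite max_r; lra.
  rewrite max_l; last lra.
  rewrite addr0; apply/eqP; rewrite eq_le v0 andbT leNgt; apply/negP => /tmin; lra.
rewrite !split_sum mulrDr lerD //; last first.
  by rewrite mulrCA ler_pM2l ?lev.
apply: IH => [||s s0].
- move: lt_m; rewrite ltnS; apply: leq_trans.
  apply: proper_card; apply/properP; split.
    apply/subsetP => x; rewrite !inE /v' lt_max ltxx /=; lra.
  by exists x1; rewrite ?inE // /v' -/t subrr maxxx ltxx.
- by move=> x; rewrite /v' le_max lexx.
- have E C : [set x in C | s <= v' x] = [set x in C | s + t <= v x].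
    apply/setP => x; rewrite !inE /v' le_max leNgt s0 /= lerBrDr //.
  by rewrite !E lev // addr_gt0.
Qed.

End Sums.

(** * Weighted rank functions and the greedy invariant *)

Section WeightedRank.
Variables (R : realType) (U : finType) (I : {set {set U}}) (w : U -> R).
Hypothesis I_indep : independence_system I.
Hypothesis w_ge0 : forall x, 0 <= w x.
Local Notation f := (weighted_rank I w).
Implicit Types (S X Y Z : {set U}).

Lemma weight_le_rank Z X : Z \in I -> Z \subset X -> \sum_(x in Z) w x <= f X.
Proof.
move=> ZI ZX; rewrite /weighted_rank (bigD1 Z) ?ZI //=.
by rewrite le_max lexx.
Qed.

Lemma weighted_rank_attained X :
  exists Z, [/\ Z \in I, Z \subset X & f X = \sum_(x in Z) w x].
Proof.
rewrite /weighted_rank; apply: (big_ind (fun r =>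
  exists Z, [/\ Z \in I, Z \subset X & r = \sum_(x in Z) w x])).
- by exists set0; rewrite big_set0 sub0set; case: I_indep.
- move=> a b Ha Hb; rewrite /Num.max; by case: ifP.
- by move=> Z /andP[ZI ZX]; exists Z.
Qed.

Lemma weighted_rank_indep S : S \in I -> f S = \sum_(x in S) w x.
Proof.
move=> SI; apply/eqP; rewrite eq_le weight_le_rank // andbT.
by have [Z [_ ZS ->]] := weighted_rank_attained S; apply: ler_sum_subset.
Qed.

Lemma weighted_rank_set0 : f set0 = 0.
Proof. by rewrite weighted_rank_indep ?big_set0 //; case: I_indep. Qed.

Lemma weighted_rank_monotone : monotone f.
Proof.
move=> X Y XY; have [Z [ZI ZX ->]] := weighted_rank_attained X.
exact: weight_le_rank (subset_trans ZX XY).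
Qed.

(** The singletons of an optimal independent set are independent, so their ranks add up to its
    weight. *)
Lemma weighted_rank_le_sum1 X : f X <= \sum_(x in X) f [set x].
Proof.
have [Z [ZI ZX ->]] := weighted_rank_attained X.
apply: le_trans (_ : \sum_(x in Z) f [set x] <= _); last first.
  apply: ler_sum_subset => // x.
  by rewrite -weighted_rank_set0; apply/weighted_rank_monotone/sub0set.
apply: ler_sum => x xZ; rewrite weighted_rank_indep ?big_set1 //.
by have [_ sub] := I_indep; apply: sub ZI; rewrite sub1set.
Qed.

(* Invariant of the sets produced by adding independent elements by
   nonincreasing weight. *)
Definition greedy_independent S :=
  S \in I /\
  forall x, x \notin S -> x |: [set s in S | w x <= w s] \in I ->
    forall s, s \in S -> w x <= w s.

Lemma greedy_independent0 : greedy_independent set0.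
Proof. by split=> [|x _ _ s]; [case: I_indep | rewrite inE]. Qed.

Variant rank_step_spec S x : R -> Prop :=
| RankStepAdd of x |: S \in I & (forall s, s \in S -> w x <= w s) :
    rank_step_spec S x (f S + w x)
| RankStepStall of x |: [set s in S | w x <= w s] \notin I :
    rank_step_spec S x (f S).

(** If [x] fits with the elements of S at least as heavy, the invariant makes these all of S.
    Otherwise an independent subset of S ∪ {x} containing [x] misses one of them, and exchanging [x]
    for it loses no weight. *)
Lemma rank_stepP S x : greedy_independent S -> x \notin S ->
  rank_step_spec S x (f (S :|: [set x])).
Proof.
move=> [SI SQ] xS; rewrite setUC.
have [xI|xnI] := boolP (x |: [set s in S | w x <= w s] \in I).
  have wmin := SQ x xS xI.
  have E : [set s in S | w x <= w s] = S.
    by apply/setP => s; rewrite inE; case: (boolP (s \in S)) => //= /wmin.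
  rewrite E in xI.
  by rewrite (weighted_rank_indep xI) big_setU1 //= addrC -weighted_rank_indep //;
    constructor.
suff -> : f (x |: S) = f S by constructor.
apply/eqP; rewrite eq_le; apply/andP; split; last exact/weighted_rank_monotone/subsetUr.
have [Z [ZI ZX ->]] := weighted_rank_attained (x |: S).
have [ZS|] := boolP (Z \subset S); first exact: weight_le_rank.
move=> nZS; have xZ : x \in Z.
  apply: contraNT nZS => xZ; apply/subsetP => z zZ.
  have := subsetP ZX z zZ; rewrite !inE => /predU1P[zx|//].
  by rewrite zx (negbTE xZ) in zZ.
have [s sS swx] : exists2 s, s \in S & (w x <= w s) && (s \notin Z).
  apply/exists_inP; apply: contraNT xnI; rewrite negb_exists_in => /forall_inP H.
  have [_ sub] := I_indep; apply: sub ZI; rewrite subUset sub1set xZ /=.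
  apply/subsetP => s; rewrite inE => /andP[sS xs].
  by have := H s sS; rewrite xs negbK.
move: swx => /andP[xs sZ].
rewrite weighted_rank_indep // (big_setD1 x) //= (big_setD1 s sS) /= lerD //.
apply: ler_sum_subset => //; apply/subsetP => z; rewrite !inE => /andP[zx zZ].
have := subsetP ZX z zZ; rewrite !inE (negbTE zx) /= => ->.
by rewrite andbT; apply: contraNneq sZ => <-.
Qed.

(** A strict gain means that [x] fits with all of S. A further [y] that fits with the elements of S
    ∪ {x} at least as heavy would already have gained [w y] at S, so the greedy choice of [x] gives
    [w y <= w x]. *)
Lemma greedy_independent_step S x : greedy_independent S -> x \notin S ->
  (forall y, y \notin S -> f (S :|: [set y]) <= f (S :|: [set x])) ->
  f S < f (S :|: [set x]) -> greedy_independent (S :|: [set x]).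
Proof.
move=> SQ xS; have [SI SQ2] := SQ.
case: (rank_stepP SQ xS) => [xI xw xmax _|_ _]; last by rewrite ltxx.
rewrite setUC; split=> // y; rewrite !inE negb_or => /andP[yx yS] yI.
have yI' : y |: [set s in S | w y <= w s] \in I.
  have [_ sub] := I_indep; apply: sub yI; rewrite setUS //.
  by apply/subsetP => s; rewrite !inE => /andP[-> ->]; rewrite orbT.
have ymin := SQ2 y yS yI'.
move=> s; rewrite !inE => /predU1P[->|]; last exact: ymin.
have := xmax y yS; case: (rank_stepP SQ yS) => [_ _|]; last by rewrite yI'.
by rewrite lerD2l.
Qed.

Lemma rank_quotient_card (q : R) X B B' : q <= rank_quotient R I ->
  B \in bases I X -> B' \in bases I X -> q * #|B'|%:R <= #|B|%:R.
Proof.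
move=> hq BX B'X; have : q <= quot #|B|%:R #|B'|%:R.
  apply: le_trans hq _; apply: (bigmin_inf X) => //.
  by apply: (bigmin_inf B) => //; apply: bigmin_le_cond.
rewrite /quot !pnatr_eq0; case: ifP => [/andP[/eqP-> /eqP->]|_]; first by rewrite mulr0.
have [->|/negbTE b0] := eqVneq #|B'| 0%N; first by rewrite mulr0 ler0n.
by rewrite ler_pdivlMr // ltr0n lt0n b0.
Qed.

(* Lowering the weights outside [S] by the largest gain [d] leaves every upper
   level set of [S] a basis of the corresponding level set of [S :|: Y]. *)
Lemma greedy_independent_augmentable (q : R) S Y :
  0 < q -> q <= rank_quotient R I -> greedy_independent S -> ~~ (Y \subset S) ->
  exists2 y, y \in Y &
    (f (S :|: Y) - q^-1 * f S) / #|Y|%:R <= f (S :|: [set y]) - f S.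
Proof.
move=> q0 hq SQ; have [SI _] := SQ => /subsetPn[y0 y0Y _].
have [y yY ymax] := @Order.TotalTheory.arg_maxP _ _ _ y0 (mem Y)
  (fun y => f (S :|: [set y])) y0Y.
exists y => //; set d := f (S :|: [set y]) - f S.
have d0 : 0 <= d by rewrite subr_ge0 weighted_rank_monotone ?subsetUl.
(* Such an [x] cannot fit: its gain would be [w x], above the maximum [d]. *)
have stall x : x \in Y -> x \notin S -> d < w x ->
    x |: [set s in S | w x <= w s] \notin I.
  move=> xY xS dx; have : f (S :|: [set x]) - f S <= d by rewrite lerD2r; exact: ymax.
  by case: (rank_stepP SQ xS) => // _ _ h; lra.
have [O [OI OX ->]] := weighted_rank_attained (S :|: Y).
have Y0 : 0 < #|Y|%:R :> R by rewrite ltr0n card_gt0; apply/set0Pn; exists y.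
rewrite ler_pdivrMr // lerBlDr.
pose v x := if x \in S then w x else Num.max 0 (w x - d).
have v0 x : 0 <= v x by rewrite /v; case: ifP => // _; rewrite le_max lexx.
(* Lowering costs at most [d] for each element of [O] outside S, and these all lie in Y. *)
have leO : \sum_(x in O) w x <= d * #|Y|%:R + \sum_(x in O) v x.
  have -> : d * #|Y|%:R = \sum_(x in Y) d by rewrite sumr_const mulr_natr.
  apply: le_trans (_ : \sum_(x in O :\: S) d + \sum_(x in O) v x <= _).
    rewrite (big_setID S) /= [X in _ <= _ + X](big_setID S) /= addrCA lerD //.
      by apply: ler_sum => x /setIP[_ xS]; rewrite /v xS.
    rewrite -big_split; apply: ler_sum => x /setDP[_ xS] /=.
    rewrite /v (negbTE xS) -lerBlDl le_max lexx orbT //.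
  rewrite lerD2r; apply: ler_sum_subset => //.
  apply/subsetP => x /setDP[xO xS].
  by have := subsetP OX x xO; rewrite inE (negbTE xS).
apply: (le_trans leO); rewrite lerD2l.
have -> : f S = \sum_(x in S) v x.
  by rewrite weighted_rank_indep //; apply: eq_bigr => x xS; rewrite /v xS.
apply: ler_sum_level_sets => // t t0.
rewrite -ler_pdivrMl ?invr_gt0 // invrK.
pose X := [set x in S :|: Y | t <= v x].
have [_ sub] := I_indep.
(* The level set of [O] is independent but perhaps not maximal; the rank quotient compares bases, so
   it is first extended to one. *)
have [B Bmax OB] : {B | maxset (fun B : {set U} => (B \in I) && (B \subset X)) B
                      & [set x in O | t <= v x] \subset B}.
  apply: maxset_exists; apply/andP; split.
    by apply: sub OI; apply/subsetP => x; rewrite inE => /andP[].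
  apply/subsetP => x; rewrite !inE => /andP[xO ->].
  by have := subsetP OX x xO; rewrite inE => ->.
apply: le_trans (_ : q * #|B|%:R <= _).
  by rewrite ler_pM2l // ler_nat subset_leq_card.
apply: (@rank_quotient_card _ X) => //; last by rewrite inE.
rewrite inE; apply/maxsetP; split.
  apply/andP; split.
    by apply: sub SI; apply/subsetP => x; rewrite inE => /andP[].
  by apply/subsetP => x; rewrite !inE => /andP[-> ->].
(* An element of [C] outside S weighs at least [t + d], so it is blocked by the elements of S of at
   least its weight; these reach level [t], hence lie in [C]. *)
move=> C /andP[CI CX] SC; apply/eqP; rewrite eqEsubset SC andbT.
apply/subsetP => x xC; have := subsetP CX x xC; rewrite !inE => /andP[xSY tx].
rewrite tx andbT; apply: contraTT CI => xS.
have xY : x \in Y by rewrite (negbTE xS) in xSY.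
move: tx; rewrite /v (negbTE xS) le_max leNgt t0 /= => tx.
apply: contra (stall x xY xS _); last lra.
apply: sub; rewrite subUset sub1set xC /=; apply/subsetP => s.
rewrite inE => /andP[sS xs]; apply: (subsetP SC); rewrite inE sS /v sS; lra.
Qed.

End WeightedRank.

(** * Greedy runs; weakly submodular and augmentable functions *)

Section GreedyRuns.
Variables (R : realType) (U : finType) (f : {set U} -> R) (r : #|U|.-tuple U).
Hypothesis r_greedy : is_greedy_run f r.

Lemma greedy_set0 : greedy_set r 0 = set0.
Proof. by apply/setP => x; rewrite !inE take0. Qed.

Lemma greedy_setS (i : 'I_#|U|) :
  greedy_set r i.+1 = greedy_set r i :|: [set tnth r i].
Proof.
apply/setP => x; rewrite !inE (tnth_nth x) (take_nth x) ?size_tuple //.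
by rewrite mem_rcons inE orbC.
Qed.

(** A run never repeats an element, so it exhausts U; this provides a qualifying index for
    [kbar]. *)
Lemma greedy_setT : greedy_set r #|U| = setT.
Proof.
have cardS k : (k <= #|U|)%N -> #|greedy_set r k| = k.
  elim: k => [|k IH] ltk; first by rewrite greedy_set0 cards0.
  have [notin _] := r_greedy (Ordinal ltk).
  by rewrite (greedy_setS (Ordinal ltk)) setUC cardsU1 notin IH // ltnW.
by apply/eqP; rewrite eqEcard subsetT cardsT cardS /=.
Qed.

Lemma unsaturated_lt_kbar (i : nat) :
  (0 < i < kbar f r)%N -> ~~ saturated f (greedy_set r i).
Proof.
move=> /andP[i0 ik].
have U0 : (0 < #|U|)%N.
  exact: leq_trans (leq_ltn_trans (leq0n i) ik) (leq_ord _).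
move: ik; rewrite /kbar; case: arg_minnP => [|k Pk kmin ik].
  rewrite U0 greedy_setT; apply/forall_inP => x; by rewrite !inE.
have lti : (i < #|U|.+1)%N by apply: ltn_trans ik (ltn_ord k).
apply/negP => sat; have := kmin (Ordinal lti).
by rewrite /= i0 sat leqNgt ik => /(_ isT).
Qed.

Lemma weak_submodularity_sum (gamma : R) i Y : 0 < gamma -> monotone f ->
  gamma <= weak_submodularity_ratio f r -> (i <= kbar f r)%N ->
  gamma * (f (greedy_set r i :|: Y) - f (greedy_set r i)) <=
  \sum_(y in Y :\: greedy_set r i)
    (f (greedy_set r i :|: [set y]) - f (greedy_set r i)).
Proof.
set S := greedy_set r i => g0 fm hg hi.
(* The ratio ranges only over sets disjoint from S, hence [Y :\: S]. *)
have : gamma <= marginal_ratio f S (Y :\: S).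
  apply: le_trans hg _; rewrite /weak_submodularity_ratio.
  apply: (bigmin_inf (@Ordinal (kbar f r).+1 i hi)) => //.
  by apply: bigmin_le_cond; rewrite setDE subsetIr.
have SUD : S :|: (Y :\: S) = S :|: Y.
  by apply/setP => x; rewrite !in_setU in_setD; case: (x \in S).
rewrite /marginal_ratio SUD.
set a := \sum_(y in _) _; set b := f _ - _.
have a0 : 0 <= a by apply: sumr_ge0 => y _; rewrite subr_ge0 fm ?subsetUl.
have b0 : 0 <= b by rewrite subr_ge0 fm ?subsetUl.
have [->|bn0] := eqVneq b 0; first by rewrite mulr0.
by rewrite /quot (negbTE bn0) andbF ler_pdivlMr // lt_def bn0.
Qed.

(** Averaging: the largest gain over Y, times |Y|, bounds the sum of the gains over Y outside S;
    [gamma <= A] then allows [A] in front of f(S). *)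
Lemma weak_submodularity_weakly_augmentable (gamma A : R) :
  0 < gamma -> gamma <= A -> (forall X, 0 <= f X) -> monotone f ->
  gamma <= weak_submodularity_ratio f r -> weakly_augmentable gamma A f r.
Proof.
move=> g0 gA f0 fm hg i hi Y /subsetPn[y0 y0Y _].
have := weak_submodularity_sum Y g0 fm hg hi; set S := greedy_set r i => key.
have [y yY ymax] := @Order.TotalTheory.arg_maxP _ _ _ y0 (mem Y)
  (fun y => f (S :|: [set y])) y0Y.
exists y => //; set d := f (S :|: [set y]) - f S.
have Y0 : 0 < #|Y|%:R :> R by rewrite ltr0n card_gt0; apply/set0Pn; exists y.
rewrite ler_pdivrMr //.
apply: le_trans (_ : gamma * (f (S :|: Y) - f S) <= _).
  by rewrite mulrBr lerD2l lerN2 ler_wpM2r.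
apply: (le_trans key); apply: le_trans (_ : \sum_(x in Y :\: S) d <= _).
  by apply: ler_sum => x /setDP[xY _]; rewrite lerD2r; exact: ymax.
rewrite sumr_const -[_ *+ _]mulr_natr ler_wpM2l ?ler_nat ?subset_leq_card ?subsetDl //.
by rewrite subr_ge0 fm ?subsetUl.
Qed.

Lemma augmentable_weakly_augmentable (gamma alpha A : R) :
  gamma <= 1 -> alpha <= A -> (forall X, 0 <= f X) ->
  augmentable alpha f -> weakly_augmentable gamma A f r.
Proof.
move=> g1 aA f0 faug i _ Y YS; have [y /setDP[yY _] yge] := faug _ _ YS.
exists y => //; apply: le_trans yge; rewrite ler_wpM2r ?invr_ge0 ?ler0n //.
by rewrite lerB ?ler_wpM2r // ler_piMl.
Qed.

End GreedyRuns.

(** * Greedy runs on weighted rank functions *)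

Section WeightedRankRuns.
Variables (R : realType) (U : finType) (I : {set {set U}}) (w : U -> R).
Hypothesis I_indep : independence_system I.
Hypothesis w_ge0 : forall x, 0 <= w x.
Local Notation f := (weighted_rank I w).
Variable r : #|U|.-tuple U.
Hypothesis r_greedy : is_greedy_run f r.

(** On a nonempty ground set [kbar] is at least 1 even if the empty set is saturated, and the first
    greedy element may then be dependent. In this degenerate case f vanishes. *)
Lemma weighted_rank_saturated0 X : saturated f set0 -> f X = 0.
Proof.
move=> /forall_inP sat; apply/eqP; rewrite eq_le; apply/andP; split; last first.
  by rewrite -(weighted_rank_set0 I_indep w_ge0); apply/weighted_rank_monotone/sub0set.
apply: le_trans (weighted_rank_le_sum1 I_indep w_ge0 X) _.
rewrite big1 // => x _; have x0 : x \in ~: set0 by rewrite !inE.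
by have /eqP := sat x x0; rewrite set0U weighted_rank_set0.
Qed.

(** Every greedy set before [kbar] is unsaturated, the empty one by assumption, so the next greedy
    element gains strictly and preserves the invariant. *)
Lemma greedy_set_independent i : ~~ saturated f set0 -> (i <= kbar f r)%N ->
  greedy_independent I w (greedy_set r i).
Proof.
move=> nsat; elim: i => [_|i IH ik].
  by rewrite greedy_set0; apply: greedy_independent0.
have iU : (i < #|U|)%N by apply: leq_trans ik (leq_ord _).
have [xS xmax] := r_greedy (Ordinal iU).
rewrite (greedy_setS r (Ordinal iU)).
apply: greedy_independent_step => //; first exact/IH/ltnW.
have : ~~ saturated f (greedy_set r i).
  case: (posnP i) => [->|i0]; first by rewrite greedy_set0.
  by apply: unsaturated_lt_kbar; rewrite // i0.
rewrite negb_forall_in => /exists_inP[y]; rewrite inE => yS yne.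
apply: lt_le_trans (xmax y yS); rewrite lt_def yne.
exact/weighted_rank_monotone/subsetUl.
Qed.

Lemma weighted_rank_weakly_augmentable (q gamma A : R) :
  0 < q -> q <= rank_quotient R I -> gamma <= 1 -> q^-1 <= A ->
  weakly_augmentable gamma A f r.
Proof.
move=> q0 hq g1 qA i hi Y YS.
have [sat|nsat] := boolP (saturated f set0).
  have [y yY _] := subsetPn YS; exists y => //.
  by rewrite !weighted_rank_saturated0 // !mulr0 subrr mul0r.
have [y yY yge] := greedy_independent_augmentable I_indep w_ge0 q0 hq
  (greedy_set_independent nsat hi) YS.
have f0 X : 0 <= f X.
  by rewrite -(weighted_rank_set0 I_indep w_ge0); apply/weighted_rank_monotone/sub0set.
exists y => //; apply: le_trans yge; rewrite ler_wpM2r ?invr_ge0 ?ler0n //.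
by rewrite lerB ?ler_wpM2r // ler_piMl.
Qed.

End WeightedRankRuns.

(** * The hub function, outside the three smaller classes *)

Section Hub.
Variables (R : realType) (n : nat) (c : R).
Hypothesis c_gt1 : 1 < c.
Local Notation V := 'I_n.+2.

(* No element but the hub [ord0] has value of its own, and with the hub every
   further element is worth [c]. *)
Definition hub_function (X : {set V}) : R :=
  if ord0 \in X then 1 + c * #|X :\ ord0|%:R else 0.

Lemma hub_function_ge0 X : 0 <= hub_function X.
Proof.
rewrite /hub_function; case: ifP => // _.
by rewrite addr_ge0 // mulr_ge0 ?ler0n // ltW // (lt_trans ltr01).
Qed.

Lemma hub_function_monotone : monotone hub_function.
Proof.
move=> X Y XY; rewrite {1}/hub_function; case: ifP => [X0|_].
  rewrite /hub_function (subsetP XY) // lerD2l.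
  rewrite ler_wpM2l ?(ltW (lt_trans ltr01 c_gt1)) //.
  by rewrite ler_nat subset_leq_card // setSD.
exact: hub_function_ge0.
Qed.

Lemma hub_function0 : hub_function set0 = 0.
Proof. by rewrite /hub_function inE. Qed.

Lemma hub_function1 x : hub_function [set x] = (x == ord0)%:R.
Proof.
rewrite /hub_function inE eq_sym; case: eqP => // ->.
by rewrite setDv cards0 mulr0 addr0.
Qed.

Lemma hub_functionT : hub_function setT = 1 + c * n.+1%:R.
Proof.
have := cardsD1 ord0 [set: V]; rewrite inE cardsT card_ord add1n => -[n1].
by rewrite /hub_function inE -n1.
Qed.

Lemma hub_functionU1 (X : {set V}) x : ord0 \in X -> x \notin X ->
  hub_function (X :|: [set x]) = hub_function X + c.
Proof.
move=> X0 xX; rewrite /hub_function inE X0 /= setUC.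
have -> : (x |: X) :\ ord0 = x |: (X :\ ord0).
  apply/setP => z; rewrite !inE; case: (z =P x) => [->|//].
  by rewrite orTb andbT; apply: contraNneq xX => ->.
by rewrite cardsU1 !inE (negbTE xX) andbF natrD mulrDr mulr1 -addrA [c + _]addrC.
Qed.

Definition hub_run : #|V|.-tuple V := enum_tuple V.

Lemma hub_run_enum : hub_run = ord0 :: behead (enum V) :> seq V.
Proof. by rewrite /= enum_ordSl. Qed.

Lemma ord0_hub_greedy_set i : (ord0 \in greedy_set hub_run i) = (0 < i)%N.
Proof. by rewrite inE hub_run_enum; case: i => // i; rewrite inE eqxx. Qed.

(** The enumeration starts with the hub, the only singleton of positive value; afterwards every
    remaining element gains [c], so any order is greedy. *)
Lemma hub_run_greedy : is_greedy_run hub_function hub_run.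
Proof.
move=> i; have notin : tnth hub_run i \notin greedy_set hub_run i.
  rewrite inE (tnth_nth ord0) /=.
  have iU : (i < size (enum V))%N by rewrite -cardE.
  have : uniq (take i.+1 (enum V)) by rewrite take_uniq ?enum_uniq.
  by rewrite (take_nth ord0) // rcons_uniq => /andP[].
split=> // y yS; have [i0|i0] := posnP i; last first.
  by rewrite !hub_functionU1 // ord0_hub_greedy_set.
have -> : tnth hub_run i = ord0 by rewrite (tnth_nth ord0) hub_run_enum i0.
rewrite i0 greedy_set0 !set0U !hub_function1 eqxx.
by rewrite ler_nat leq_b1.
Qed.

Definition hub : greedy_fun R := GreedyFun hub_function_ge0 hub_run_greedy.

(** At the empty set, if Y contains the hub, it gains 1 and f(Y) / c = 1 / c + |Y| - 1 <= |Y|;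
    otherwise f(Y) = 0. Once S contains the hub, a new element gains [c], while f(S ∪ Y) - f(S) <= c
    |Y|. *)
Lemma hub_weakly_augmentable (a : R) : c^-1 <= a -> Fweakaug c^-1 a hub.
Proof.
move=> ca; have c0 : 0 < c by apply: lt_trans c_gt1.
split=> [|i _ Y YS] /=; first exact: hub_function_monotone.
have Y0 : 0 < #|Y|%:R :> R.
  by rewrite ltr0n card_gt0; apply: contraNneq YS => ->; apply: sub0set.
set S := greedy_set _ i in YS *; have [i0|i0] := posnP i.
  have S0 : S = set0 by rewrite /S i0 greedy_set0.
  have [Yh|Yh] := boolP (ord0 \in Y).
    exists ord0 => //; rewrite S0 !set0U hub_function1 eqxx.
    rewrite hub_function0 mulr0 !subr0 ler_pdivrMr // mul1r.
    rewrite /hub_function Yh ler_pdivrMl // (cardsD1 ord0 Y) Yh natrD mulrDr mulr1.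
    by rewrite lerD2r ltW.
  have [y yY _] := subsetPn YS; exists y => //.
  rewrite S0 !set0U hub_function0 {1}/hub_function (negbTE Yh).
  by rewrite !mulr0 !subr0 mul0r hub_function_ge0.
have Sh : ord0 \in S by rewrite ord0_hub_greedy_set.
have [y yY yS] := subsetPn YS; exists y => //.
rewrite hub_functionU1 // [leRHS]addrC addKr ler_pdivrMr //.
apply: le_trans (_ : c^-1 * (hub_function (S :|: Y) - hub_function S) <= _).
  by rewrite mulrBr lerD2l lerN2 ler_wpM2r ?hub_function_ge0.
apply: le_trans (_ : #|Y|%:R <= _); last by rewrite ler_peMl ?ltW.
rewrite /hub_function inE Sh /= opprD addrACA subrr add0r -mulrBr mulKf ?gt_eqF //.
rewrite lerBlDr -natrD ler_nat setDUl.
apply: leq_trans (leq_card_setU _ _) _; rewrite addnC leq_add2r.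
by rewrite subset_leq_card // subsetDl.
Qed.

(** At the empty set the gains of all elements sum to 1, less than gamma f(U). *)
Lemma hub_not_weaksub (gamma : R) :
  1 < gamma * (1 + c * n.+1%:R) -> 0 < gamma -> ~ Fweaksub gamma hub.
Proof.
move=> big g0 [fm hg]; have := weak_submodularity_sum setT g0 fm hg (leq0n _).
rewrite /= greedy_set0 set0U setD0 hub_functionT.
rewrite (bigD1 ord0) ?inE //= big1 => [|x /andP[_ /negbTE x0]].
  by rewrite set0U hub_function1 hub_function0 eqxx !subr0 addr0 leNgt big.
by rewrite set0U hub_function1 hub_function0 x0 subr0.
Qed.

(** From the empty set no gain exceeds 1, but the average f(U) / |U| does, as [c > 1]. *)
Lemma hub_not_augmentable (alpha : R) : ~ Faug alpha hub.
Proof.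
move=> [_ /(_ set0 setT)] /=; case.
  by apply/subsetPn; exists ord0; rewrite !inE.
move=> y _; rewrite !set0U hub_functionT hub_function1 hub_function0.
rewrite mulr0 !subr0 cardsT card_ord ler_pdivrMr ?ltr0n //.
have : (y == ord0)%:R <= 1 :> R by case: (y == ord0); rewrite ?lexx ?ler01.
have : 0 < n.+1%:R :> R by rewrite ltr0n.
by have := c_gt1; rewrite (natrD _ 1 n.+1); nra.
Qed.

(** The values of the singletons sum to 1 < f(U), against [weighted_rank_le_sum1]. *)
Lemma hub_not_weighted_rank (q : R) : ~ Frank q hub.
Proof.
move=> [I [w [Iind w0 _ E]]]; have := weighted_rank_le_sum1 Iind w0 setT.
rewrite -E /= hub_functionT; under eq_bigr do rewrite -E /= hub_function1.
rewrite (bigD1 ord0) ?inE //= big1 => [|x /andP[_ /negbTE->//]]; rewrite addr0.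
have : 0 < n.+1%:R :> R by rewrite ltr0n.
by have := c_gt1; nra.
Qed.

End Hub.

Theorem theorem5 (R : realType) (gamma q gamma' alpha alpha' : R)
    (hgamma : 0 < gamma <= 1) (hq : 0 < q <= 1) (hgamma' : 0 < gamma' < 1)
    (halpha : 1 <= alpha) (halpha' : gamma' <= alpha') :
  (forall f : greedy_fun R,
     Fweaksub gamma f \/ Faug alpha f \/ Frank q f ->
     Fweakaug gamma (Num.max alpha (1 / q)) f) /\
  ~ (forall f : greedy_fun R,
       Fweakaug gamma' alpha' f ->
       Fweaksub gamma f \/ Faug alpha f \/ Frank q f).
Proof.
case/andP: hgamma hq hgamma' => g0 g1 /andP[q0 q1] /andP[g'0 g'1].
split=> [f|incl].
  have gA : gamma <= Num.max alpha (1 / q) by rewrite le_max (le_trans g1 halpha).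
  case=> [[fm fr]|[[fm fa]|]].
  - split=> //; exact: weak_submodularity_weakly_augmentable g0 gA (@fn_ge0 _ f) fm fr.
  - split=> //; apply: augmentable_weakly_augmentable g1 _ (@fn_ge0 _ f) fa.
    by rewrite le_max lexx.
  - case=> [I [w [Iind w0 Iq /funext fE]]].
    have rg := @run_greedy _ f; rewrite fE in rg.
    rewrite /Fweakaug fE; split; first exact: weighted_rank_monotone.
    apply: weighted_rank_weakly_augmentable q0 Iq g1 _ => //.
    by rewrite le_max div1r lexx orbT.
have c1 : 1 < gamma'^-1 by rewrite invf_gt1.
(* The Archimedean bound gives [n > 1 / gamma], so f(U) exceeds 1 / gamma as well. *)
pose n := Num.bound gamma^-1.
have big : 1 < gamma * (1 + gamma'^-1 * n.+1%:R).
  have hn : gamma^-1 < n%:R.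
    by apply: archi_boundP; rewrite invr_ge0 ltW.
  rewrite -ltr_pdivrMl // mulr1 (lt_trans hn) // -natr1.
  have : 0 <= n%:R :> R by rewrite ler0n.
  nra.
have := @hub_weakly_augmentable _ n _ c1 alpha'.
rewrite invrK => /(_ halpha') /incl.
case=> [|[]].
- exact: hub_not_weaksub.
- exact: hub_not_augmentable.
- exact: hub_not_weighted_rank.
Qed.
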